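(* Let $T$ be a non-trivial group and $m\geqslant 2$ an integer. Except for the cases $(T,m)=(C_2,2)$, $(C_3,2)$, $(C_2\times C_2,2)$, and $(C_2,3)$ (up to isomorphism of $T$), the diagonal semilattice $\mathfrak{D}(T,m)$ and the diagonal graph $\Gamma_D(T,m)$ have the same automorphism group, namely the diagonal group $D(T,m)$.
   Context: $T$ may be finite or infinite; $C_n$ denotes the cyclic group of order $n$. Elements of $\Omega=T^m$ are written $[t_1,\ldots,t_m]$. Diagonal group. The pre-diagonal group $\widehat D(T,m)$ is the semidirect product $T^{m+1}\rtimes(\mathrm{Aut}(T)\times S_{m+1})$, where $\mathrm{Aut}(T)$ acts in the same way on each factor and $S_{m+1}$ permutes the factors. Let $\delta(T,m+1)=\{(t,\ldots,t)\mid t\in T\}\leqslant T^{m+1}$ and $\widehat H=\delta(T,m+1)\rtimes(\mathrm{Aut}(T)\times S_{m+1})$. The diagonal group $D(T,m)$ is the permutation group induced by $\widehat D(T,m)$ on the right cosets of $\widehat H$. Numbering the factors of $T^{m+1}$ as $0,\ldots,m$ and writing $[t_1,\ldots,t_m]$ for the coset of $(1,t_1,\ldots,t_m)$, this coset set is identified with $\Omega=T^m$, and $D(T,m)$ is the permutation group on $T^m$ generated by: right multiplications of the $i$th coordinate by elements of $T$ ($1\leqslant i\leqslant m$); simultaneous left multiplication of all coordinates by an element of $T$; automorphisms of $T$ applied simultaneously to all coordinates; permutations of the $m$ coordinates; and the map $[t_1,t_2,\ldots,t_m]\mapsto[t_1^{-1},t_1^{-1}t_2,\ldots,t_1^{-1}t_m]$.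 Diagonal semilattice. For $1\leqslant i\leqslant m$ let $T_i\leqslant T^m$ be the $i$th coordinate subgroup and let $T_0=\{[t,\ldots,t]\mid t\in T\}$. Let $Q_i$ be the partition of $T^m$ into right cosets of $T_i$ ($0\leqslant i\leqslant m$). For $I\subseteq\{0,\ldots,m\}$ let $Q_I=\bigvee_{i\in I}Q_i$, the supremum in the lattice of all partitions of $T^m$ ordered by refinement ($P\preccurlyeq Q$ iff every part of $P$ lies in a part of $Q$), with $Q_\emptyset$ the partition into singletons. Then $\mathfrak{D}(T,m)=\{Q_I\mid I\subseteq\{0,\ldots,m\}\}$. An automorphism of a set of partitions is a permutation of the underlying set that preserves the set of partitions. Diagonal graph. $\Gamma_D(T,m)$ has vertex set $T^m$; two distinct vertices are adjacent iff they lie in the same part of $Q_i$ for some $i\in\{0,\ldots,m\}$ (i.e. they differ in exactly one coordinate, or one is obtained from the other by left-multiplying all coordinates by the same non-identity element of $T$). *)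

(* Defs.v *)
From HB Require Import structures.
From mathcomp Require Import all_boot all_fingroup all_algebra.
From mathcomp Require Import boolp classical_sets.

Set Implicit Arguments.
Unset Strict Implicit.
Unset Printing Implicit Defensive.

Local Open Scope group_scope.
Local Open Scope classical_set_scope.

Definition group_iso (G H : groupType) (f : G -> H) : Prop :=
  bijective f /\ {morph f : x y / x * y}.

Definition isomorphic (G H : groupType) : Prop :=
  exists f : G -> H, group_iso f.

(* A partition is the set of its parts; [classical_sets.partition P id setT]
   says that the parts are nonempty, pairwise disjoint and cover the type. *)
Section Partitions.
Variable X : Type.
Implicit Types (P Q : set (set X)) (F : set (set (set X))).

Definition is_partition P : Prop := classical_sets.partition P id [set: X].

Definition refines P Q : Prop :=
  forall A, P A -> exists2 B, Q B & A `<=` B.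

Definition is_partition_sup F Q : Prop :=
  [/\ is_partition Q, (forall P, F P -> refines P Q)
    & forall R, is_partition R -> (forall P, F P -> refines P R) ->
        refines Q R].

Lemma partition_uniq P A B x :
  is_partition P -> P A -> P B -> A x -> B x -> A = B.
Proof. by move=> [_ tP _] PA PB Ax Bx; apply: tP => //; exists x. Qed.

Lemma partition_ex P x : is_partition P -> exists2 A, P A & A x.
Proof.
move=> [cP _ _]; have : [set: X] x by [].
by rewrite -cP => -[A PA Ax]; exists A.
Qed.

Lemma partition_sup_exists F :
  (forall P, F P -> is_partition P) -> exists Q, is_partition_sup F Q.
Proof.
move=> FP.
pose ub R := is_partition R /\ forall P, F P -> refines P R.
pose cl (x : X) : set X := [set y | forall R A, ub R -> R A -> A x -> A y].
have clxx x : cl x x by [].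
have clC x y : cl x y -> cl y x.
  move=> xy R A uR RA Ay; have [B RB Bx] := partition_ex x uR.1.
  by rewrite (partition_uniq uR.1 RA RB Ay (xy R B uR RB Bx)).
have clT x y z : cl x y -> cl y z -> cl x z.
  by move=> xy yz R A uR RA Ax; apply: (yz R A) => //; apply: xy uR RA Ax.
have sub x z : cl x z -> cl x `<=` cl z.
  by move=> xz w xw; apply: clT xw; apply: clC.
exists (range cl); split.
- split.
  + by apply/seteqP; split=> // x _; exists (cl x) => //; exists x.
  + move=> _ _ [x _ <-] [y _ <-] [z [/= xz yz]].
    have xy : cl x y by apply: clT (clC _ _ yz).
    by apply/seteqP; split; apply: sub => //; apply: clC.
  + by move=> _ [x _ <-]; exists x.
- move=> P PF A PA; have partP := FP P PF.
  have [x Ax] : A !=set0 by case: partP => _ _; apply.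
  exists (cl x); first by exists x.
  move=> y Ay R B [partR /(_ P PF A PA) [C RC AC]] RB Bx.
  by rewrite (partition_uniq partR RB RC Bx (AC x Ax)); apply: AC.
- move=> R partR FR _ [x _ <-]; have [B RB Bx] := partition_ex x partR.
  by exists B => // y; apply: (fun h => h R B (conj partR FR) RB Bx).
Qed.

Lemma partition_sup_unique F Q R :
  is_partition_sup F Q -> is_partition_sup F R -> Q = R.
Proof.
suff sub S U : is_partition_sup F S -> is_partition_sup F U -> S `<=` U.
  by move=> QF RF; apply/seteqP; split; apply: sub.
move=> [pS ubS lS] [pU ubU lU] A SA.
have [B UB AB] := lS _ pU ubU A SA.
have [C SC BC] := lU _ pS ubS B UB.
have [x Ax] : A !=set0 by case: pS => _ _; apply.
have AC : A = C by apply: (partition_uniq pS SA SC Ax); apply/BC/AB.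
by have <- : B = A by apply/seteqP; split=> //; rewrite AC.
Qed.

(* [g @` A] is the image of the part A, so [image_partition g P] is P^g. *)
Definition image_partition (g : X -> X) P : set (set X) :=
  [set g @` A | A in P].

Definition partitions_aut F : set (X -> X) :=
  [set g | bijective g /\ image_partition g @` F = F].

Definition graph_aut (adj : X -> X -> Prop) : set (X -> X) :=
  [set g | bijective g /\ forall x y, adj (g x) (g y) <-> adj x y].

End Partitions.

Section Diagonal.
Variables (T : groupType) (m : nat).

(* T^m is a group under the pointwise product; the coordinates t_1, ..., t_m
   are indexed by 'I_m.  The index set {0, ..., m} is 'I_m.+1: [ord0] is the
   extra factor and [lift ord0 i] stands for the coordinate i : 'I_m. *)
Definition Omega : groupType := {ffun 'I_m -> T}.

Definition coord_subgroup (i : 'I_m) : set Omega :=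
  [set t : Omega | forall j, j != i -> t j = 1].

Definition diag_subgroup : set Omega :=
  [set t : Omega | exists a : T, forall j, t j = a].

Definition subgroup_T (i : 'I_m.+1) : set Omega :=
  if unlift ord0 i is Some j then coord_subgroup j else diag_subgroup.

Definition right_cosets (H : set Omega) : set (set Omega) :=
  [set [set h * x | h in H] | x in [set: Omega]].

Definition partition_Q (i : 'I_m.+1) : set (set Omega) :=
  right_cosets (subgroup_T i).

(* As an element of this set, Q is the supremum Q_I for some I; the empty I
   gives the least partition, that is, the one into singletons. *)
Definition diagonal_semilattice : set (set (set Omega)) :=
  [set Q | exists I : {set 'I_m.+1},
     is_partition_sup [set partition_Q i | i in [set` I]] Q].

Definition diagonal_graph (x y : Omega) : Prop :=
  x <> y /\
  exists i : 'I_m.+1, exists A, [/\ partition_Q i A, A x & A y].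

(* The semidirect product T^{m+1} : (Aut(T) x S_{m+1}).  The triple
   (phi, s, a) denotes the element (phi, s) a, with the complement on the left
   of the normal subgroup, so that
     (phi, s) a (psi, r) b = (phi psi, s r) a^(psi, r) b.
   Actions are on the right: phi psi is [psi \o phi], the product s * r of
   permutations applies s first, and factor i of a is moved to factor r i. *)
Definition triple : Type := ((T -> T) * 'S_m.+1 * {ffun 'I_m.+1 -> T})%type.

Definition prediagonal_group : set triple :=
  [set x | group_iso (x.1.1 : T -> T)].

Definition triple_mul (x y : triple) : triple :=
  (y.1.1 \o x.1.1, x.1.2 * y.1.2,
   [ffun i => y.1.1 (x.2 (y.1.2^-1 i)) * y.2 i]).

Definition prediagonal_H : set triple :=
  [set x | prediagonal_group x /\ exists a : T, forall i, x.2 i = a].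

(* (1, t_1, ..., t_m) *)
Definition embed (t : Omega) : triple :=
  (id, 1, [ffun i => if unlift ord0 i is Some j then t j else 1]).

(* The right coset of H written [t_1, ..., t_m]. *)
Definition coset_of_tuple (t : Omega) : set triple :=
  [set triple_mul h (embed t) | h in prediagonal_H].

Definition diagonal_group : set (Omega -> Omega) :=
  [set g | exists2 x, prediagonal_group x &
     forall t, [set triple_mul y x | y in coset_of_tuple t]
               = coset_of_tuple (g t)].

(* The image of [t] under the right multiplication by [x], read off from the
   tuple (1, t_1, ..., t_m) x after normalising its factor 0 to 1. *)
Definition triple_act (x : triple) (t : Omega) : Omega :=
  let b := (triple_mul (embed t) x).2 in
  [ffun i => (b ord0)^-1 * b (lift ord0 i)].

Lemma group_iso1 (f : T -> T) : group_iso f -> f 1 = 1.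
Proof.
by move=> [_ fM]; apply: (@mulgI _ (f 1)); rewrite -fM !mulg1.
Qed.

Lemma group_isoV (f : T -> T) (x : T) : group_iso f -> f x^-1 = (f x)^-1.
Proof.
move=> isof; apply: (@mulgI _ (f x)).
by rewrite -isof.2 !mulgV group_iso1.
Qed.

Lemma group_iso_id : group_iso (id : T -> T).
Proof. by split=> //; exists id. Qed.

Lemma group_iso_comp (f g : T -> T) :
  group_iso f -> group_iso g -> group_iso (g \o f).
Proof.
move=> [bf fM] [bg gM]; split; first exact: bij_comp.
by move=> x y /=; rewrite fM gM.
Qed.

Lemma group_iso_inv (f g : T -> T) :
  group_iso f -> cancel f g -> cancel g f -> group_iso g.
Proof.
move=> [_ fM] fK gK; split; first by exists f.
by move=> x y; rewrite -{1}(gK x) -{1}(gK y) -fM fK.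
Qed.

Lemma triple_mulA x y z : prediagonal_group z ->
  triple_mul x (triple_mul y z) = triple_mul (triple_mul x y) z.
Proof.
move=> [_ zM]; rewrite /triple_mul /= mulgA; congr (_, _, _).
by apply/ffunP => i; rewrite !ffunE /= zM invMg permM mulgA.
Qed.

(* The tuples [t_1, ..., t_m] are in bijection with the right cosets of H. *)
Lemma coset_of_tupleP (t : Omega) (z : triple) :
  coset_of_tuple t z <->
  prediagonal_group z /\ forall i, z.2 (lift ord0 i) = z.2 ord0 * t i.
Proof.
split=> [[[[phi s] a] [/= isoh [c ac]] <-]|[isoz zt]].
  split; first by apply: group_iso_comp => //; exact: group_iso_id.
  by move=> i; rewrite /= !ffunE liftK unlift_none mulg1 !ac.
exists (z.1, [ffun=> z.2 ord0]).
  by split=> //; exists (z.2 ord0) => i; rewrite ffunE.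
case: z isoz zt => [[phi s] a] /= isoz zt; congr (_, _, _).
  by rewrite mulg1.
apply/ffunP => i; rewrite !ffunE /=.
by case: unliftP => [j|] -> //; rewrite mulg1.
Qed.

Lemma coset_of_tuple_inj : injective coset_of_tuple.
Proof.
move=> t u tu; apply/ffunP => i.
have : coset_of_tuple t (embed t).
  apply/coset_of_tupleP; split; first exact: group_iso_id.
  by move=> j; rewrite /= !ffunE liftK unlift_none mul1g.
rewrite tu => /coset_of_tupleP[_ /(_ i)] /=.
by rewrite !ffunE liftK unlift_none mul1g.
Qed.

Lemma coset_of_tuple_surj (x : triple) : prediagonal_group x ->
  exists t, [set triple_mul h x | h in prediagonal_H] = coset_of_tuple t.
Proof.
move=> isox; exists [ffun i => (x.2 ord0)^-1 * x.2 (lift ord0 i)].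
apply/seteqP; split=> z.
  move=> [[[phi s] a] [isoh [c ac]] <-]; apply/coset_of_tupleP; split.
    exact: group_iso_comp.
  by move=> i; rewrite /= !ffunE !ac mulgA mulgK.
move=> /coset_of_tupleP[isoz zt].
have [[g xg gx] xM] := isox; have isog := group_iso_inv isox xg gx.
exists (g \o z.1.1, z.1.2 * x.1.2^-1, [ffun=> g (z.2 ord0 * (x.2 ord0)^-1)]).
  split; first exact: group_iso_comp.
  by exists (g (z.2 ord0 * (x.2 ord0)^-1)) => i; rewrite ffunE.
case: z isoz zt => [[phi s] a] /= isoz zt; rewrite /triple_mul /=.
congr (_, _, _); first by apply/funext => t /=; rewrite gx.
  by rewrite mulgKV.
apply/ffunP => i; rewrite !ffunE gx.
case: (unliftP ord0 i) => [j|] ->; last by rewrite mulgVK.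
by rewrite zt ffunE mulgA.
Qed.

Lemma triple_act_cosetE (x : triple) (t : Omega) : prediagonal_group x ->
  [set triple_mul y x | y in coset_of_tuple t] =
  coset_of_tuple (triple_act x t).
Proof.
move=> isox; pose e := triple_mul (embed t) x.
have isoe : prediagonal_group e by apply: group_iso_comp isox; exact: group_iso_id.
have [u ue] := coset_of_tuple_surj isoe.
have eE : [set triple_mul y x | y in coset_of_tuple t] = coset_of_tuple u.
  rewrite -ue; apply/seteqP; split=> z.
    by move=> [_ [h hH <-] <-]; exists h; rewrite // triple_mulA.
  move=> [h hH <-]; exists (triple_mul h (embed t)); first by exists h.
  by rewrite /e triple_mulA.
rewrite eE; congr coset_of_tuple; apply/ffunP => i; rewrite ffunE.
have : coset_of_tuple u e.
  rewrite -ue; exists (id, 1, [ffun=> 1]).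
    by split; [exact: group_iso_id | exists 1 => j; rewrite ffunE].
  case: {+}e isoe => [[phi s] a] isoe; rewrite /triple_mul /= mul1g.
  congr (_, _, _); apply/ffunP => j; rewrite !ffunE.
  by rewrite (group_iso1 isoe : phi 1 = 1) mul1g.
by move=> /coset_of_tupleP[_ ->]; rewrite mulKg.
Qed.

Lemma diagonal_groupE :
  diagonal_group = [set triple_act x | x in prediagonal_group].
Proof.
apply/seteqP; split=> g.
  move=> [x isox gx]; exists x => //; apply/funext => t.
  by apply: coset_of_tuple_inj; rewrite -triple_act_cosetE // gx.
by move=> [x isox <-]; exists x => // t; apply: triple_act_cosetE.
Qed.

End Diagonal.

Arguments diagonal_semilattice : clear implicits.
Arguments diagonal_graph : clear implicits.
Arguments diagonal_group : clear implicits.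

(* The generators of the diagonal group on T^m, stated for m = n + 1 so that
   there is a first coordinate. *)
Section Generators.
Variables (T : groupType) (n : nat).
Let m := n.+1.

Definition permutation_group (X : Type) (G : set (X -> X)) : Prop :=
  [/\ (forall g, G g -> bijective g), G id,
      (forall f g, G f -> G g -> G (g \o f))
    & (forall f g, G f -> cancel f g -> cancel g f -> G g)].

Definition right_mult (i : 'I_m) (a : T) (t : Omega T m) : Omega T m :=
  [ffun j => if j == i then t j * a else t j].

Definition left_mult (a : T) (t : Omega T m) : Omega T m :=
  [ffun j => a * t j].

Definition aut_act (phi : T -> T) (t : Omega T m) : Omega T m :=
  [ffun j => phi (t j)].

Definition coord_perm (s : 'S_m) (t : Omega T m) : Omega T m :=
  [ffun j => t (s j)].

(* [t_1, t_2, ..., t_m] |-> [t_1^-1, t_1^-1 t_2, ..., t_1^-1 t_m] *)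
Definition swap0 (t : Omega T m) : Omega T m :=
  [ffun j => if j == ord0 then (t ord0)^-1 else (t ord0)^-1 * t j].

Definition diagonal_generators : set (Omega T m -> Omega T m) :=
  [set right_mult i a | i in setT & a in setT] `|`
  [set left_mult a | a in setT] `|`
  [set aut_act phi | phi in [set phi : T -> T | group_iso phi]] `|`
  [set coord_perm s | s in setT] `|`
  [set swap0].

Lemma triple_act_mul (x y : triple T m) t :
  prediagonal_group x -> prediagonal_group y ->
  triple_act y (triple_act x t) = triple_act (triple_mul x y) t.
Proof.
move=> isox isoy; apply: coset_of_tuple_inj.
rewrite -triple_act_cosetE // -!triple_act_cosetE //; last exact: group_iso_comp.
apply/seteqP; split=> z.
  move=> [_ [w wt <-] <-]; exists w => //.
  by rewrite triple_mulA.
move=> [w wt <-]; exists (triple_mul w x); first by exists w.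
by rewrite triple_mulA.
Qed.

Lemma triple_actE (phi : T -> T) (s : 'S_m.+1) a t i :
  triple_act (phi, s, a) t i =
  (phi ((embed t).2 (s^-1 ord0)) * a ord0)^-1 *
  (phi ((embed t).2 (s^-1 (lift ord0 i))) * a (lift ord0 i)).
Proof. by rewrite ffunE [in LHS]/triple_mul /= [in LHS]ffunE [X in _ * X]ffunE. Qed.

Lemma embed0 (t : Omega T m) : (embed t).2 ord0 = 1.
Proof. by rewrite ffunE unlift_none. Qed.

Lemma embedS (t : Omega T m) i : (embed t).2 (lift ord0 i) = t i.
Proof. by rewrite ffunE liftK. Qed.

Lemma triple_act1 : triple_act (id, 1, [ffun=> 1]) = id :> (Omega T m -> _).
Proof.
apply/funext => t; apply/ffunP => i.
by rewrite triple_actE invg1 !perm1 embed0 embedS !ffunE !mulg1 invg1 mul1g.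
Qed.

Lemma triple_act_linv (x : triple T m) : prediagonal_group x ->
  exists2 y : triple T m, prediagonal_group y & cancel (triple_act x) (triple_act y).
Proof.
move: x => [[phi s] a] /= isophi; have [[psi fK Kf] _] := isophi.
have isopsi := group_iso_inv isophi fK Kf.
exists (psi, s^-1, [ffun i => (psi (a (s i)))^-1]) => // t.
rewrite triple_act_mul // -[RHS](congr1 (fun f => f t) triple_act1).
congr triple_act; rewrite /triple_mul /= mulgV; congr (_, _, _).
  by apply/funext => u /=; rewrite fK.
by apply/ffunP => i; rewrite !ffunE invgK mulgV.
Qed.

Lemma diagonal_group_permutation_group : permutation_group (diagonal_group T m).
Proof.
have inv x g : prediagonal_group x -> cancel g (triple_act x) ->
    exists2 y, prediagonal_group y & triple_act y = g :> (Omega T m -> _).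
  move=> isox gx; have [y isoy xy] := triple_act_linv isox.
  by exists y => //; apply/funext => t; rewrite -{1}(gx t) xy.
rewrite diagonal_groupE; split.
- move=> _ [x isox <-]; have [y isoy xy] := triple_act_linv isox.
  have [w _ yw] := triple_act_linv isoy.
  by exists (triple_act y) => // t; rewrite -(yw (triple_act x _)) xy yw.
- by exists (id, 1, [ffun=> 1]); [exact: group_iso_id | exact: triple_act1].
- move=> _ _ [x isox <-] [y isoy <-]; exists (triple_mul x y).
    exact: group_iso_comp.
  by apply/funext => t; rewrite /= triple_act_mul.
- by move=> _ g [x isox <-] xg gx; apply: (inv x).
Qed.

Lemma smallest_in (G : set (Omega T m -> Omega T m)) g :
  G g -> smallest (@permutation_group _) G g.
Proof. by move=> Gg M [_]; apply. Qed.

Lemma smallest_comp (G : set (Omega T m -> Omega T m)) f g :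
  smallest (@permutation_group _) G f -> smallest (@permutation_group _) G g ->
  smallest (@permutation_group _) G (g \o f).
Proof.
move=> Gf Gg M MG; have [[_ _ compM _] _] := MG.
by apply: compM; [apply: Gf | apply: Gg].
Qed.

Lemma smallest_id (G : set (Omega T m -> Omega T m)) :
  smallest (@permutation_group _) G id.
Proof. by move=> M [[]]. Qed.

Lemma diagonal_group_generated :
  diagonal_group T m = smallest (@permutation_group _) diagonal_generators.
Proof.
set G := diagonal_generators; set C := smallest _ _.
apply/seteqP; split; last first.
  move=> g; apply; split; first exact: diagonal_group_permutation_group.
  rewrite diagonal_groupE => {}g [[[[|]|]|]|].
  - move=> [i _ [a _ <-]].
    exists (id, 1, [ffun j => if j == lift ord0 i then a else 1]).
      exact: group_iso_id.
    apply/funext => t; apply/ffunP => j.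
    rewrite triple_actE invg1 !perm1 embed0 embedS !ffunE.
    rewrite (inj_eq lift_inj) (negPf (neq_lift _ _)) mulg1 invg1 mul1g.
    by case: eqP => // _; rewrite mulg1.
  - move=> [a _ <-].
    exists (id, 1, [ffun j => if j == ord0 then a^-1 else 1]).
      exact: group_iso_id.
    apply/funext => t; apply/ffunP => j.
    rewrite triple_actE invg1 !perm1 embed0 embedS !ffunE.
    by rewrite eqxx eq_sym (negPf (neq_lift _ _)) mul1g invgK mulg1.
  - move=> [phi isophi <-]; exists (phi, 1, [ffun=> 1]) => //.
    apply/funext => t; apply/ffunP => j.
    rewrite triple_actE invg1 !perm1 embed0 embedS !ffunE.
    by rewrite (group_iso1 isophi) !mulg1 invg1 mul1g.
  - move=> [s _ <-]; exists (id, (lift_perm ord0 ord0 s)^-1, [ffun=> 1]).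
      exact: group_iso_id.
    apply/funext => t; apply/ffunP => j.
    rewrite triple_actE invgK lift_perm_id lift_perm_lift embed0 embedS !ffunE.
    by rewrite !mulg1 invg1 mul1g.
  - move=> ->; exists (id, tperm ord0 (lift ord0 ord0), [ffun=> 1]).
      exact: group_iso_id.
    apply/funext => t; apply/ffunP => j.
    rewrite triple_actE tpermV tpermL embedS [RHS]ffunE !ffunE !mulg1.
    case: eqP => [->|/eqP j0]; first by rewrite tpermR unlift_none mulg1.
    by rewrite tpermD ?liftK ?neq_lift // (inj_eq lift_inj) eq_sym.
rewrite diagonal_groupE => _ [[[phi s] a] isophi <-].
have tripleE : triple_act (phi, s, a) =
    (triple_act (id, 1, a) \o aut_act phi) \o triple_act (id, s, [ffun=> 1]).
  apply/funext => t; apply/ffunP => i /=.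
  rewrite !triple_actE invg1 !perm1 embed0 embedS !ffunE mul1g.
  rewrite !mulg1 (isophi.2 : {morph phi : x y / x * y}) (group_isoV _ (isophi : group_iso phi)) invMg.
  by rewrite ?ffunE !mulgA.
rewrite tripleE; apply: smallest_comp; last apply: smallest_comp.
- have actM r q : C (triple_act (id, r, [ffun=> 1])) ->
      C (triple_act (id, q, [ffun=> 1])) -> C (triple_act (id, r * q, [ffun=> 1])).
    move=> Cr Cq; have -> : triple_act (id, r * q, [ffun=> 1]) =
        triple_act (id, q, [ffun=> 1]) \o triple_act (id, r, [ffun=> 1])
        :> (Omega T m -> _); last exact: smallest_comp.
      apply/funext => t /=; rewrite triple_act_mul; try exact: group_iso_id.
      congr triple_act; congr (_, _, _).
      by apply/ffunP => i; rewrite !ffunE mulg1.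
  have CS (i j : 'I_m) :
      C (triple_act (id, tperm (lift ord0 i) (lift ord0 j), [ffun=> 1])).
    apply: smallest_in; left; right; exists (tperm i j) => //.
    apply/funext => t; apply/ffunP => k.
    rewrite triple_actE tpermV tpermD ?(eq_sym _ ord0) ?neq_lift // embed0.
    rewrite -(inj_tperm _ _ _ (@lift_inj _ ord0)) embedS !ffunE.
    by rewrite !mulg1 invg1 mul1g.
  have C0 : C (triple_act (id, tperm ord0 (lift ord0 ord0), [ffun=> 1])).
    apply: smallest_in; right; apply/funext => t; apply/ffunP => j.
    rewrite triple_actE tpermV tpermL embedS [RHS]ffunE !ffunE !mulg1.
    case: eqP => [->|/eqP j0]; first by rewrite tpermR unlift_none mulg1.
    by rewrite tpermD ?liftK ?neq_lift // (inj_eq lift_inj) eq_sym.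
  have C0S (j : 'I_m) : C (triple_act (id, tperm ord0 (lift ord0 j), [ffun=> 1])).
    have [->//|j0] := eqVneq j ord0.
    have -> : tperm ord0 (lift ord0 j) =
        tperm (lift ord0 ord0) (lift ord0 j) *
        (tperm ord0 (lift ord0 ord0) * tperm (lift ord0 ord0) (lift ord0 j)).
      rewrite -{1}(tpermV (lift ord0 ord0)) -[RHS]/(_ ^ _) tpermJ tpermL.
      by rewrite tpermD // eq_sym neq_lift.
    exact: (actM _ _ (CS _ _) (actM _ _ C0 (CS _ _))).
  have [ts -> _] := prod_tpermP s; elim: ts => [|[i j] ts IH].
    by rewrite big_nil triple_act1; apply: smallest_id.
  rewrite big_cons; apply: actM => //=.
  case: (unliftP ord0 i) => [i' ->|->]; case: (unliftP ord0 j) => [j' ->|->] //.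
    by rewrite tpermC.
  by rewrite tperm1 triple_act1; apply: smallest_id.
- by apply: smallest_in; left; left; right; exists phi.
- pose u k (t : Omega T m) : Omega T m :=
    [ffun j : 'I_m => if (j < k)%N then t j * a (lift ord0 j) else t j].
  have -> : triple_act (id, 1, a) = left_mult (a ord0)^-1 \o u m.
    apply/funext => t; apply/ffunP => j.
    by rewrite triple_actE invg1 !perm1 embed0 embedS !ffunE ltn_ord mul1g.
  apply: smallest_comp; last first.
    by apply: smallest_in; do 3 left; right; exists (a ord0)^-1.
  suff Cu k : (k <= m)%N -> C (u k) by apply: Cu.
  elim: k => [_|k IH km].
    have -> : u 0%N = id by apply/funext => t; apply/ffunP => j; rewrite ffunE.
    exact: smallest_id.
  pose i := Ordinal km.
  have -> : u k.+1 = right_mult i (a (lift ord0 i)) \o u k.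
    apply/funext => t; apply/ffunP => j; rewrite !ffunE ltnS -val_eqE /=.
    by case: ltngtP => // ji; rewrite (_ : j = i) //; apply: val_inj.
  apply: smallest_comp; first by apply: IH; apply: ltnW.
  by apply: smallest_in; do 4 left; exists i => //; exists (a (lift ord0 i)).
Qed.

End Generators.

(* Main.v *)
(* Up to a common left factor, a vertex is a tuple (t_0, ..., t_m), and two
   vertices lie in the same part of Q_i ("on a line of direction i") when such
   tuples differ at most in factor i.  A permutation f of T^m which maps lines
   of direction i to lines of direction s(i), for a permutation s of
   {0, ..., m}, is in the diagonal group: composing with an element of that
   group, s = 1 and f fixes [1, ..., 1]; then f acts on each coordinate
   separately, by the same map on all of them, and this map is an automorphism.

   Automorphisms of the semilattice permute its atoms, which are the Q_i.

   For the graph, one recovers first the lines and then the directions.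
   If m >= 3, every triangle is contained in a line.  If m = 2, every 5-clique
   is contained in a line, and so is every 4-clique containing an edge along
   which a coordinate is multiplied by t with t^2 <> 1; outside the exceptional
   cases, |T| >= 5, or |T| >= 4 and such a t exists.  Hence lines are mapped to
   lines, and it remains to see that parallel lines remain parallel.  If m = 2,
   two lines are not parallel if and only if they meet in exactly one point.  If
   m >= 3, parallelism is carried by the squares x, y, z, w in which y and w have
   no common neighbours but x and z; there are enough of them as soon as m >= 4
   or |T| >= 3. *)
Require Import Defs.
From mathcomp Require Import all_boot all_fingroup all_algebra.
From mathcomp Require Import boolp classical_sets.

Set Implicit Arguments.
Unset Strict Implicit.
Unset Printing Implicit Defensive.

Local Open Scope group_scope.
Local Open Scope classical_set_scope.

(** * Homogeneous coordinates *)

Section Lines.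
Variables (T : groupType) (n : nat).
Let m := n.+2.
Implicit Types (x y z w : Omega T m) (i j k l : 'I_m.+1) (v : 'I_m.+1 -> T).

(* The homogeneous coordinates of [t_1, ..., t_m]: t_0 = 1, t_1, ..., t_m. *)
Definition hc x k : T := (embed x).2 k.

(* Same part of Q_i: up to a common left factor, (1, t_1, ..., t_m) is changed
   in factor i only.  This form is symmetric in the m + 1 directions. *)
Definition same_part i x y : Prop :=
  exists a, forall k, k != i -> hc y k = a * hc x k.

Lemma hc0 x : hc x ord0 = 1.
Proof. exact: embed0. Qed.

Lemma hcS x (i : 'I_m) : hc x (lift ord0 i) = x i.
Proof. exact: embedS. Qed.

Lemma ex_notin (I : finType) (s : seq I) :
  (size s < #|I|)%N -> exists k : I, k \notin s.
Proof.
move=> sI; apply/existsP; apply: contraLR sI.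
rewrite negb_exists -leqNgt cardE => /forallP sI.
by apply: uniq_leq_size (enum_uniq _) _ => k _; rewrite -[_ \in _]negbK.
Qed.

Lemma ex_other i j : exists k, (k != i) && (k != j).
Proof.
have [|k] := @ex_notin _ [:: i; j]; first by rewrite card_ord.
by rewrite !inE negb_or; exists k.
Qed.

Lemma hc_inj a x y : (forall k, hc y k = a * hc x k) -> x = y.
Proof.
move=> xy; have a1 : a = 1 by have := xy ord0; rewrite !hc0 mulg1.
by apply/ffunP => i; rewrite -!hcS xy a1 mul1g.
Qed.

Lemma same_refl i x : same_part i x x.
Proof. by exists 1 => k _; rewrite mul1g. Qed.

Lemma same_sym i x y : same_part i x y -> same_part i y x.
Proof. by move=> [a xy]; exists a^-1 => k ki; rewrite xy // mulKg. Qed.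

Lemma same_trans i x y z : same_part i x y -> same_part i y z -> same_part i x z.
Proof.
by move=> [a xy] [b yz]; exists (b * a) => k ki; rewrite yz // xy // mulgA.
Qed.

(** A third factor exists because [m + 1 >= 3]; comparing it shows that the two left multipliers
    agree, so all homogeneous coordinates are proportional. *)
Lemma same_eq i j x y : i != j -> same_part i x y -> same_part j x y -> x = y.
Proof.
move=> ij [a xy] [b xy']; have [k /andP[ki kj]] := ex_other i j.
have ab : a = b by apply: (@mulIg _ (hc x k)); rewrite -xy // -xy'.
apply: (@hc_inj a) => l; have [->|/xy //] := eqVneq l i.
by rewrite ab xy'.
Qed.

(** The left multiplication by [(v ord0)^-1] normalises factor 0 to 1. *)
Definition vertex v : Omega T m := [ffun i => (v ord0)^-1 * v (lift ord0 i)].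

Lemma hc_vertex v k : hc (vertex v) k = (v ord0)^-1 * v k.
Proof.
by case: (unliftP ord0 k) => [j|] ->; rewrite ?hcS ?ffunE // hc0 mulVg.
Qed.

Lemma same_vertex i x v a :
  (forall k, k != i -> v k = a * hc x k) -> same_part i x (vertex v).
Proof.
by move=> xv; exists ((v ord0)^-1 * a) => k ki; rewrite hc_vertex (xv k) // mulgA.
Qed.

(** For [i = ord0] the normalisation turns this into left multiplication of all coordinates by
    [t^-1]. *)
Definition shift i t x : Omega T m :=
  vertex (fun k => if k == i then hc x k * t else hc x k).

Lemma same_shift i t x : same_part i x (shift i t x).
Proof. by apply: (@same_vertex _ _ _ 1) => k /negPf->; rewrite mul1g. Qed.

Lemma hc_shift i t x : exists2 a, (forall k, k != i -> hc (shift i t x) k = a * hc x k)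
  & hc (shift i t x) i = a * hc x i * t.
Proof.
eexists; first by move=> k /negPf ki; rewrite hc_vertex ki.
by rewrite hc_vertex eqxx mulgA.
Qed.

Lemma shift_inj i x : injective (shift i ^~ x).
Proof.
move=> t s /= ts; have [a ta tai] := hc_shift i t x.
have [b sb sbi] := hc_shift i s x.
have [k /andP[ki _]] := ex_other i i.
have ab : a = b by apply: (@mulIg _ (hc x k)); rewrite -ta // -sb // ts.
by apply: (@mulgI _ (a * hc x i)); rewrite -tai ts sbi ab.
Qed.

Lemma shift1 i x : shift i 1 x = x.
Proof.
apply/esym/(@hc_inj (hc x ord0)^-1) => k.
by rewrite hc_vertex !mulg1 !if_same.
Qed.

Lemma shift_neq i t x : t != 1 -> x <> shift i t x.
Proof. by move=> /eqP t1 xt; apply/t1/(@shift_inj i x); rewrite /= shift1. Qed.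

Lemma same_shiftP i x y : same_part i x y -> exists t, y = shift i t x.
Proof.
(* The witness solves [a * hc x i * t = hc y i] for [t]. *)
move=> [a xy]; exists ((hc x i)^-1 * a^-1 * hc y i).
have [b sb sbi] := hc_shift i ((hc x i)^-1 * a^-1 * hc y i) x.
apply: (@hc_inj (b * a^-1)) => k; have [->|ki] := eqVneq k i.
  by rewrite sbi !mulgA mulgK.
by rewrite sb // xy // mulgA mulgVK.
Qed.

Lemma same0 x y : same_part ord0 x y <-> exists a, forall p : 'I_m, y p = a * x p.
Proof.
split=> -[a xy]; exists a => k; first by rewrite -!hcS xy.
by case: (unliftP ord0 k) => [j|] -> // _; rewrite !hcS.
Qed.

Lemma sameS (i : 'I_m) x y :
  same_part (lift ord0 i) x y <-> forall p, p != i -> y p = x p.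
Proof.
split=> [[a xy] j ji|xy].
  have a1 : a = 1 by have := xy ord0 isT; rewrite !hc0 mulg1.
  by rewrite -!hcS xy ?a1 ?mul1g // (inj_eq lift_inj).
exists 1 => k; rewrite mul1g; case: (unliftP ord0 k) => [j|] ->.
  by rewrite (inj_eq lift_inj) !hcS; apply: xy.
by rewrite !hc0.
Qed.

(** Connectedness: the coordinates of [x] are replaced by those of [y] one at a time, in order, and
    [u d] has the first [d] of them replaced. *)
Lemma same_ind (P : Omega T m -> Prop) x y :
  P x -> (forall (p : 'I_m) z w, x p != y p -> same_part (lift ord0 p) z w -> P z -> P w) ->
  P y.
Proof.
move=> Px stepP; pose u d : Omega T m := [ffun q : 'I_m => if (q < d)%N then y q else x q].
have -> : y = u m by apply/ffunP => q; rewrite ffunE ltn_ord.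
suff IH d : (d <= m)%N -> P (u d) by apply: IH.
elim: d => [_|d IH dm].
  by have -> : u 0%N = x by apply/ffunP => q; rewrite ffunE.
have [xyd|xyd] := eqVneq (x (Ordinal dm)) (y (Ordinal dm)); last first.
  apply: (stepP _ _ _ xyd) (IH (ltnW dm)).
  apply/(@sameS (Ordinal dm)) => q qd; rewrite !ffunE ltnS [(q <= d)%N]leq_eqVlt.
  by rewrite (negPf (qd : q != d :> nat)).
suff -> : u d.+1 = u d by apply: IH; apply: ltnW.
apply/ffunP => q; rewrite !ffunE ltnS [(q <= d)%N]leq_eqVlt.
have [/= qd|//] := eqVneq (q : nat) d.
have -> : q = Ordinal dm by apply: val_inj.
by rewrite xyd !if_same.
Qed.

Lemma partition_QP i A x :
  partition_Q i A -> A x -> A = [set y | same_part i x y].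
Proof.
move=> [z _ <-] [u ui <-] {A x}.
have sameE y : same_part i (u * z) y <-> subgroup_T i (y * z^-1 : Omega T m).
  rewrite /subgroup_T in ui *; case: unliftP ui => [j|] -> /= ui.
    rewrite sameS; split=> yz k kj; have := yz k kj; rewrite !ffunE ui //.
      by rewrite mul1g => ->; rewrite mulgV.
    by move=> yz1; rewrite mul1g -[LHS](mulgVK (z k)) yz1 mul1g.
  have [a ua] := ui; rewrite same0; split=> -[b yz].
    by exists (b * a) => k; rewrite !ffunE yz !ffunE ua !mulgA mulgK.
  exists (b * a^-1) => k; have := yz k; rewrite !ffunE ua => <-.
  by rewrite !mulgA !mulgVK.
apply/seteqP; split=> y /=.
  by move=> [h hi <-]; apply/sameE; rewrite mulgK.
by move=> /sameE yz; exists (y * z^-1) => //; rewrite mulgVK.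
Qed.

Lemma partition_Q_same i x : partition_Q i [set y | same_part i x y].
Proof.
have Qi : partition_Q i [set (h : Omega T m) * x | h in subgroup_T i] by exists x.
rewrite -(@partition_QP i _ x Qi) //; exists 1; last by rewrite mul1g.
rewrite /subgroup_T; case: unlift => [j k _|]; first by rewrite ffunE.
by exists 1 => k; rewrite ffunE.
Qed.

Lemma same_partP i x y :
  same_part i x y <-> exists A, [/\ partition_Q i A, A x & A y].
Proof.
split=> [xy|[A [QA Ax]]]; last by rewrite (partition_QP QA Ax).
by exists [set z | same_part i x z]; split => //; [exact: partition_Q_same | exact: same_refl].
Qed.

Lemma partition_Q_neq0 i (A : set (Omega T m)) : partition_Q i A -> A !=set0.
Proof.
move=> [x _ <-]; exists x; exists 1; last by rewrite mul1g.
rewrite /subgroup_T; case: unlift => [j k _|]; first by rewrite ffunE.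
by exists 1 => k; rewrite ffunE.
Qed.

Lemma partition_Q_partition i : is_partition (@partition_Q T m i).
Proof.
split; last by move=> A /partition_Q_neq0.
- apply/seteqP; split=> // x _; exists [set y | same_part i x y].
    exact: partition_Q_same.
  exact: same_refl.
- move=> A B QA QB [x [Ax Bx]].
  by rewrite (partition_QP QA Ax) (partition_QP QB Bx).
Qed.

Lemma refines_Q i P : is_partition P ->
  refines (@partition_Q T m i) P <->
  forall x y A, same_part i x y -> P A -> A x -> A y.
Proof.
move=> partP; split=> [iP x y A xy PA Ax|iP A QA].
  have [B PB sB] := iP _ (partition_Q_same i x).
  by rewrite (partition_uniq partP PA PB Ax (sB _ (same_refl i x))); apply: sB.
have [x Ax] := partition_Q_neq0 QA; have [B PB Bx] := partition_ex x partP.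
by exists B => //; rewrite (partition_QP QA Ax) => y /= xy; apply: iP xy PB Bx.
Qed.

End Lines.

(** * Permutations of T^m that permute the directions *)

Section Directions.
Variables (T : groupType) (n : nat).
Let m := n.+2.
Implicit Types (x y z w : Omega T m) (i j k l : 'I_m.+1) (f g h : Omega T m -> Omega T m).

Definition permutes_directions (s : 'I_m.+1 -> 'I_m.+1) f : Prop :=
  forall i x y, same_part i x y -> same_part (s i) (f x) (f y).

Lemma triple_act_same phi (s : 'S_m.+1) a : group_iso phi ->
  permutes_directions s (triple_act (phi, s, a)).
Proof.
move=> isophi i x y [c xy].
have actE z : triple_act (phi, s, a) z =
    vertex (fun k => phi (hc z (s^-1 k)) * a k).
  by apply/ffunP => k; rewrite triple_actE [RHS]ffunE.
have hcE z k : hc (triple_act (phi, s, a) z) k =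
    (phi (hc z (s^-1 ord0)) * a ord0)^-1 * (phi (hc z (s^-1 k)) * a k).
  by rewrite actE hc_vertex.
rewrite [triple_act _ y]actE.
(* The last two terms of the multiplier undo the normalisation of the image of [x]. *)
apply: (@same_vertex _ _ _ _ _ (phi c * (phi (hc x (s^-1 ord0)) * a ord0))) => k ksi.
rewrite hcE xy; last by apply: contra_neq ksi => <-; rewrite permKV.
by rewrite isophi.2 -!(mulgA (phi c)) mulKVg.
Qed.

Lemma triple_act_id (phi : T -> T) : group_iso phi ->
  triple_act (phi, 1, [ffun=> 1]) = aut_act phi :> (Omega T m -> _).
Proof.
move=> isophi; apply/funext => t; apply/ffunP => j.
rewrite triple_actE invg1 !perm1 embed0 embedS !ffunE.
by rewrite (group_iso1 isophi) !mulg1 invg1 mul1g.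
Qed.

Definition cst (a : T) : Omega T m := [ffun=> a].

(* Coordinate p of h is constant along the lines in the directions other than 0 and
   p, so it only depends on the same coordinate of the argument; the lines in
   direction 0 through [1, ..., 1] then give the same map for all p, and
   those through [b, 1, ..., 1] show that it is a homomorphism. *)
Lemma aut_act_of_directions h : bijective h -> permutes_directions id h ->
  h (cst 1) = cst 1 -> exists2 phi, group_iso phi & h = aut_act phi.
Proof.
move=> [h' hK h'K] dirh h1.
have coordh x y (p : 'I_m) : x p = y p -> h x p = h y p.
  move=> xyp; apply: (@same_ind _ _ (fun z => h x p = h z p) x y) => //.
  move=> q z w xyq /dirh/sameS zw ->; apply/esym/zw.
  by apply: contra_neq xyq => <-.
pose phi a := h (cst a) ord0.
have hcst a : h (cst a) = cst (phi a).
  have : same_part ord0 (cst 1) (cst a) by apply/same0; exists a => p; rewrite !ffunE mulg1.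
  move=> /dirh/same0[b hb]; apply/ffunP => p.
  by rewrite ffunE /phi !hb h1 !ffunE.
have hE x p : h x p = phi (x p).
  by rewrite (coordh x (cst (x p))) ?hcst ffunE.
exists phi; last by apply/funext => x; apply/ffunP => p; rewrite hE ffunE.
split; first exists (fun c => h' (cst c) ord0).
- by move=> a; rewrite -hcst hK ffunE.
- by move=> c; rewrite -hE h'K ffunE.
move=> a b; pose x : Omega T m := [ffun p : 'I_m => if p == ord0 then b else 1].
pose y : Omega T m := [ffun p : 'I_m => a * x p].
have /dirh/same0[c xy] : same_part ord0 x y by apply/same0; exists a => p; rewrite ffunE.
have := xy (lift ord0 ord0); rewrite !hE !ffunE /= mulg1.
rewrite {2}/phi h1 ffunE mulg1 => ->.
by have := xy ord0; rewrite !hE !ffunE.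
Qed.

Lemma diagonal_group_of_directions (s : 'S_m.+1) f :
  bijective f -> permutes_directions s f -> diagonal_group T m f.
Proof.
move=> bijf dirf.
have [bijD _ compD invD] := diagonal_group_permutation_group T n.+1.
(* Under [s^-1], factor [s k] moves to factor [k]; multiplying there by [a k] makes the image of
   [f (cst 1)] equal to [cst 1]. *)
pose a := [ffun k => (hc (f (cst 1)) (s k))^-1].
have [g Dg gE] : exists2 g, diagonal_group T m g & g = triple_act (id, s^-1, a).
  exists (triple_act (id, s^-1, a)) => //.
  by rewrite diagonal_groupE; exists (id, s^-1, a) => //; apply: group_iso_id.
have [g' gK g'K] := bijD _ Dg.
have -> : f = g' \o (g \o f) by apply/funext => x /=; rewrite gK.
apply: compD; last exact: (invD g).
have [|||phi isophi ->] := @aut_act_of_directions (g \o f).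
- exact: bij_comp (bijD _ Dg) bijf.
- move=> i x y /dirf /=; rewrite gE.
  by move=> /(triple_act_same s^-1 a (group_iso_id T)); rewrite permK.
- have aE k : (embed (f (cst 1))).2 (s k) * a k = 1 by rewrite [a k]ffunE mulgV.
  rewrite /= gE; apply/ffunP => p; rewrite triple_actE invgK !aE.
  by rewrite invg1 mulg1 ffunE.
rewrite -triple_act_id // diagonal_groupE.
by exists (phi, 1, [ffun=> 1]).
Qed.

Lemma diagonal_group_permutes f : diagonal_group T m f ->
  exists s : 'S_m.+1, permutes_directions s f.
Proof.
rewrite diagonal_groupE => -[[[phi s] a] isophi <-].
by exists s; apply: triple_act_same.
Qed.

Hypothesis Tnt : exists t : T, t <> 1.

Lemma ex_same i x : exists2 y, x <> y & same_part i x y.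
Proof.
have [t /eqP t1] := Tnt; exists (shift i t x); first exact: shift_neq.
exact: same_shift.
Qed.

(** Lines through [x] in distinct directions meet only in [x], and each has a second point since [T]
    is non-trivial. *)
Lemma same_index i j x : (forall y, same_part i x y -> same_part j x y) -> i = j.
Proof.
move=> ij; have [y xy xiy] := ex_same i x.
by have [//|ijn] := eqVneq i j; have := same_eq ijn xiy (ij _ xiy).
Qed.

(** The inverse permutes directions too, and [same_index] shows that its direction map undoes
    [s]. *)
Lemma diagonal_group_same f : diagonal_group T m f ->
  exists s : 'S_m.+1, forall i x y, same_part (s i) (f x) (f y) <-> same_part i x y.
Proof.
have [bijD _ _ invD] := diagonal_group_permutation_group T n.+1.
move=> Df; have [g fK gK] := bijD _ Df.
have [s sf] := diagonal_group_permutes Df.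
have [r rg] := diagonal_group_permutes (invD _ _ Df fK gK).
exists s => i x y; split; last exact: sf.
have rs : r (s i) = i.
  by apply/esym/(@same_index _ _ x) => z /sf/rg; rewrite !fK.
by move=> /rg; rewrite rs !fK.
Qed.

End Directions.

(** * The diagonal semilattice *)

Section RefinementOrder.
Variable X : Type.
Implicit Types (P Q R : set (set X)) (F : set (set (set X))) (g : X -> X).

Lemma refines_refl P : refines P P.
Proof. by move=> A PA; exists A. Qed.

Lemma refines_trans P Q R : refines P Q -> refines Q R -> refines P R.
Proof.
move=> PQ QR A /PQ[B /QR[C RC BC] AB]; exists C => //.
exact: subset_trans BC.
Qed.

(** Both [P] and [Q] are suprema of the singleton of [P], and suprema are unique. *)
Lemma refines_anti P Q :
  is_partition P -> is_partition Q -> refines P Q -> refines Q P -> P = Q.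
Proof.
move=> pP pQ PQ QP; apply: (@partition_sup_unique _ [set P]).
  by split=> // [_ ->|R _ /(_ P erefl)//]; exact: refines_refl.
by split=> // [_ -> //|R _ /(_ P erefl)]; exact: refines_trans.
Qed.

Lemma image_partitionK g h P :
  cancel g h -> image_partition h (image_partition g P) = P.
Proof.
move=> gK; rewrite /image_partition image_comp -[RHS]image_id.
congr image; apply/funext => A /=; rewrite image_comp -[RHS]image_id.
by congr image; apply/funext => x /=.
Qed.

Lemma refines_image g P Q :
  refines P Q -> refines (image_partition g P) (image_partition g Q).
Proof.
move=> PQ _ [A /PQ[B QB AB] <-]; exists (g @` B); first by exists B.
exact: image_subset.
Qed.

Lemma image_is_partition g P :
  bijective g -> is_partition P -> is_partition (image_partition g P).
Proof.
move=> [h gK hK] pP; split.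
- apply/seteqP; split=> // x _.
  have [A PA Ahx] := partition_ex (h x) pP.
  by exists (g @` A); [exists A | exists (h x)].
- move=> _ _ [A PA <-] [B PB <-] [_ [[x Ax <-] [y By /(can_inj gK) yx]]].
  by rewrite (partition_uniq pP PA PB Ax) // -yx.
- move=> _ [A PA <-]; have [x Ax] : A !=set0 by case: pP => _ _; apply.
  by exists (g x); exists x.
Qed.

Lemma image_partition_sup g F Q : bijective g -> is_partition_sup F Q ->
  is_partition_sup (image_partition g @` F) (image_partition g Q).
Proof.
move=> bijg [pQ ubQ leQ]; split; first exact: image_is_partition.
  by move=> _ [P FP <-]; apply/refines_image/ubQ.
have [h gK hK] := bijg => R pR ubR.
rewrite -(image_partitionK R hK); apply: refines_image; apply: leQ.
  by apply: image_is_partition => //; exists g.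
move=> P FP; rewrite -(image_partitionK P gK); apply: refines_image.
by apply: ubR; exists P.
Qed.

(** Bottom and atoms involve only membership in [F] and refinement, so automorphisms of [F] preserve
    them. *)
Definition bottom F P : Prop := F P /\ forall Q, F Q -> refines P Q.

Definition atom F P : Prop :=
  [/\ F P, ~ bottom F P & forall Q, F Q -> refines Q P -> ~ bottom F Q -> Q = P].

Lemma aut_inv g h F : cancel g h -> cancel h g ->
  partitions_aut F g -> partitions_aut F h.
Proof.
move=> gK hK [_ gF]; split; first by exists g.
rewrite -{1}gF image_comp -[RHS]image_id; congr image.
by apply/funext => P /=; apply: image_partitionK.
Qed.

Lemma aut_mem g F P : partitions_aut F g -> F P -> F (image_partition g P).
Proof. by move=> [_ gF] FP; rewrite -gF; exists P. Qed.

Lemma aut_bottom g F P :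
  partitions_aut F g -> bottom F P -> bottom F (image_partition g P).
Proof.
move=> gF [FP botP]; split; first exact: aut_mem.
move=> Q; rewrite -gF.2 => -[R FR <-].
exact/refines_image/botP.
Qed.

Lemma aut_atom g F P :
  partitions_aut F g -> atom F P -> atom F (image_partition g P).
Proof.
move=> gF [FP nbotP minP]; have [h gK hK] := gF.1.
have hF := aut_inv gK hK gF.
split; first exact: aut_mem.
  by move=> /(aut_bottom hF); rewrite image_partitionK.
move=> Q FQ QP nbotQ; rewrite -[LHS](image_partitionK Q hK).
congr image_partition; apply: minP; first exact: aut_mem.
  by rewrite -(image_partitionK P gK); apply: refines_image.
by move=> /(aut_bottom gF); rewrite image_partitionK.
Qed.

End RefinementOrder.

(** * Atoms and automorphisms of the diagonal semilattice *)

Section Semilattice.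
Variables (T : groupType) (n : nat).
Let m := n.+2.
Implicit Types (x y z w : Omega T m) (i j k l : 'I_m.+1) (f g h : Omega T m -> Omega T m).
Hypothesis Tnt : exists t : T, t <> 1.

Local Notation Q i := (@partition_Q T m i).
Local Notation D := (diagonal_semilattice T m).

Lemma image_partition_Q f i j : bijective f ->
  (forall x y, same_part j (f x) (f y) <-> same_part i x y) -> image_partition f (Q i) = Q j.
Proof.
move=> [g fK gK] fij.
have fE x : f @` [set y | same_part i x y] = [set y | same_part j (f x) y].
  apply/seteqP; split=> y; first by move=> [z /= xz <-]; apply/fij.
  by rewrite -{1}(gK y) => /fij xgy; exists (g y).
apply/seteqP; split=> A.
  move=> [B QB <-]; have [x Bx] := partition_Q_neq0 QB.
  rewrite (partition_QP QB Bx) fE; exact: partition_Q_same.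
move=> QA; have [x Ax] := partition_Q_neq0 QA.
exists [set y | same_part i (g x) y]; first exact: partition_Q_same.
by rewrite fE gK -(partition_QP QA Ax).
Qed.

(** The image of [Q_I] is [Q_J] with [J = s @: I]; applying this to the inverse as well gives
    equality of the two sets. *)
Lemma diagonal_group_semilattice f :
  diagonal_group T m f -> partitions_aut D f.
Proof.
have sub h : diagonal_group T m h -> image_partition h @` D `<=` D.
  move=> Dh; have [bijD _ _ _] := diagonal_group_permutation_group T n.+1.
  have bijh := bijD _ Dh.
  have [s sh] := diagonal_group_same Tnt Dh.
  move=> _ [P [I supP] <-]; exists (s @: I).
  have := image_partition_sup bijh supP; congr is_partition_sup.
  apply/seteqP; split=> R.
    move=> [_ [i /= iI <-] <-]; exists (s i); first by apply/imsetP; exists i.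
    by rewrite (image_partition_Q bijh (sh i)).
  move=> [_ /imsetP[i iI ->] <-]; exists (Q i); first by exists i.
  exact: (image_partition_Q bijh (sh i)).
move=> Df; have [bijD _ _ invD] := diagonal_group_permutation_group T n.+1.
have bijf := bijD _ Df; have [g fK gK] := bijf.
split=> //; apply/seteqP; split; first exact: sub.
move=> P DP; exists (image_partition g P); last exact: image_partitionK.
by apply: (sub g); [exact: (invD f) | exists P].
Qed.

Lemma refines_partition_Q i j : refines (Q i) (Q j) -> i = j.
Proof.
move=> /(refines_Q _ (partition_Q_partition T j)) ij.
apply: (@same_index _ _ Tnt _ _ (cst _ 1)) => y iy.
apply: (ij _ _ [set z | same_part j (cst n (1 : T)) z] iy); last exact: same_refl.
exact: partition_Q_same.
Qed.

(** [Q_I] is the bottom for empty [I] and lies above some [Q_i] otherwise, while distinct [Q_i] are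
    incomparable. *)
Lemma atomP P : atom D P <-> exists i, P = Q i.
Proof.
have DQ i : D (Q i).
  exists [set i]%SET; split; first exact: partition_Q_partition.
    by move=> _ [j /set1P-> <-]; apply: refines_refl.
  by move=> R _; apply; exists i => //=; rewrite inE.
have nbot i : ~ bottom D (Q i).
  move=> [_ botQ]; have [j /andP[/eqP ji _]] := ex_other i i.
  by apply/ji/esym/refines_partition_Q/botQ.
have part R : D R -> is_partition R by move=> [I []].
have above R : D R -> ~ bottom D R -> exists i, refines (Q i) R.
  move=> [I supR] nbotR.
  have [/set0Pn[i iI]|] := boolP (I != finset.set0).
    by exists i; have [pR ubR leR] := supR; apply: ubR; exists i.
  rewrite negbK => /eqP I0; case: nbotR; split; first by exists I.
  move=> S /part pS; have [pR ubR leR] := supR; apply: leR => // U [i].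
  by rewrite /= I0 inE.
split=> [[DP nbotP minP]|[i ->]].
  have [i iP] := above _ DP nbotP; exists i.
  by apply/esym/minP.
split=> // R DR Ri nbotR.
have [j jR] := above _ DR nbotR.
have ji := refines_partition_Q (refines_trans jR Ri).
apply: refines_anti => //; [exact: part | exact: partition_Q_partition |].
by rewrite -ji.
Qed.

Lemma semilattice_aut_directions f : partitions_aut D f ->
  exists s : 'S_m.+1, permutes_directions s f.
Proof.
move=> fD; have bijf := fD.1; have [g fK gK] := bijf.
have /choice[s sE] i : exists j, image_partition f (Q i) = Q j.
  by apply/atomP/(aut_atom fD)/atomP; exists i.
have s_inj : injective s.
  move=> i j sij; apply: refines_partition_Q.
  rewrite -(image_partitionK (Q i) fK) -(image_partitionK (Q j) fK) !sE sij.
  exact: refines_refl.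
exists (perm s_inj) => i x y /same_partP[A [QA Ax Ay]].
rewrite permE; apply/same_partP; exists (f @` A); split.
- by rewrite -sE; exists A.
- by exists x.
- by exists y.
Qed.

Lemma semilattice_autE : partitions_aut D = diagonal_group T m.
Proof.
apply/seteqP; split=> f; last exact: diagonal_group_semilattice.
move=> fD; have [s sf] := semilattice_aut_directions fD.
exact: diagonal_group_of_directions fD.1 sf.
Qed.

Lemma diagonal_graphP x y :
  diagonal_graph T m x y <-> x <> y /\ exists i, same_part i x y.
Proof.
by split=> -[xy [i]]; [move/same_partP | move/same_partP]; split=> //; exists i.
Qed.

Lemma diagonal_group_graph f :
  diagonal_group T m f -> graph_aut (diagonal_graph T m) f.
Proof.
move=> Df; have [bijD _ _ _] := diagonal_group_permutation_group T n.+1.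
have bijf := bijD _ Df; have [s sf] := diagonal_group_same Tnt Df.
split=> // x y; rewrite !diagonal_graphP.
split=> -[xy [i fxy]]; split.
- by move=> xy'; apply: xy; rewrite xy'.
- by exists (s^-1 i); apply/sf; rewrite permKV.
- by move/(bij_inj bijf).
- by exists (s i); apply/sf.
Qed.

End Semilattice.

(** * The diagonal graph *)

(** A bound [|T| >= c] that makes sense for infinite [T] as well. *)
Definition card_ge (T : eqType) (c : nat) : Prop :=
  forall s : seq T, (size s < c)%N -> exists t, t \notin s.

Lemma uniq_card_ge (T : eqType) (s : seq T) : uniq s -> card_ge T (size s).
Proof.
move=> us r rs; have [/hasP[t _ tr]|] := boolP (has [predC r] s); first by exists t.
rewrite -all_predC => /allP sr; suff : (size s <= size r)%N by rewrite leqNgt rs.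
by apply: uniq_leq_size us _ => t /sr; rewrite /= negbK.
Qed.

Section Graph.
Variables (T : groupType) (n : nat).
Let m := n.+2.
Implicit Types (x y z w v : Omega T m) (i j k l : 'I_m.+1) (f g h : Omega T m -> Omega T m).
Hypothesis Tnt : exists t : T, t <> 1.

Local Notation adj := (diagonal_graph T m).

Definition collinear x y z : Prop := exists i, same_part i x y /\ same_part i x z.

Lemma adj_near x y : adj x y -> exists i, same_part i x y.
Proof. by move=> /diagonal_graphP[]. Qed.

Lemma same_adj i x y : x <> y -> same_part i x y -> adj x y.
Proof. by move=> xy ixy; apply/diagonal_graphP; split=> //; exists i. Qed.

Lemma adj_same i x y z : y <> z -> same_part i x y -> same_part i x z -> adj y z.
Proof.
by move=> yz xy xz; apply: (same_adj yz); apply: same_trans (same_sym xy) xz.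
Qed.

Lemma same_uniq i j x y : x <> y -> same_part i x y -> same_part j x y -> i = j.
Proof.
move=> xy ixy jxy; have [//|ij] := eqVneq i j.
by case: xy; apply: same_eq ij ixy jxy.
Qed.

Lemma collinear_same i x y z :
  x <> y -> same_part i x y -> collinear x y z -> same_part i x z.
Proof. by move=> xy ixy [j [jxy jxz]]; rewrite (same_uniq xy ixy jxy). Qed.

Lemma graph_aut_inj f x y : graph_aut adj f -> f x = f y -> x = y.
Proof. by move=> [bf _]; apply: bij_inj. Qed.

Lemma graph_aut_inv f : graph_aut adj f ->
  exists g, [/\ graph_aut adj g, cancel f g & cancel g f].
Proof.
move=> [[g fK gK] fadj]; exists g; split=> //; split; first by exists f.
by move=> x y; rewrite -fadj !gK.
Qed.

Lemma graph_aut_same f i x y : graph_aut adj f -> same_part i x y ->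
  exists j, same_part j (f x) (f y).
Proof.
move=> [_ fadj] ixy; have [->|/eqP xy] := eqVneq x y.
  by exists i; apply: same_refl.
exact/adj_near/fadj/(same_adj xy ixy).
Qed.

Definition preserves_collinearity f : Prop :=
  forall x y z, collinear x y z -> collinear (f x) (f y) (f z).

Lemma preserves_collinearity_distinct f : graph_aut adj f ->
  (forall i x y z, same_part i x y -> same_part i x z -> x <> y -> x <> z -> y <> z ->
     collinear (f x) (f y) (f z)) -> preserves_collinearity f.
Proof.
move=> fA fcol x y z [i [xy xz]].
have [j fxy] := graph_aut_same fA xy.
have [k fxz] := graph_aut_same fA xz.
have [<-|/eqP nxy] := eqVneq x y; first by exists k; split=> //; apply: same_refl.
have [<-|/eqP nxz] := eqVneq x z; first by exists j; split=> //; apply: same_refl.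
have [<-|/eqP nyz] := eqVneq y z; first by exists j.
exact: fcol xy xz _ _ _.
Qed.

(** * Direction maps of a graph automorphism *)

Section DirectionMap.
Hypothesis colP : forall h, graph_aut adj h -> preserves_collinearity h.
Variable f : Omega T m -> Omega T m.
Hypothesis fA : graph_aut adj f.

(** A second point on the line fixes the image direction; collinearity is preserved by [f] and by
    its inverse, which gives both implications. *)
Lemma local_directions : exists S : Omega T m -> 'I_m.+1 -> 'I_m.+1,
  forall x i y, same_part (S x i) (f x) (f y) <-> same_part i x y.
Proof.
have [g [gA fK gK]] := graph_aut_inv fA.
suff /choice[S SP] (x : Omega T m) : exists s : 'I_m.+1 -> 'I_m.+1,
    forall i y, same_part (s i) (f x) (f y) <-> same_part i x y by exists S.
suff /choice[s sP] (i : 'I_m.+1) : exists j, forall y, same_part j (f x) (f y) <-> same_part i x y.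
  by exists s.
have [y xy ixy] := ex_same Tnt i x.
have [j fxy] := graph_aut_same fA ixy.
have nfxy : f x <> f y by move/(graph_aut_inj fA).
exists j => z; split=> [fxz|xz].
  apply: (collinear_same xy ixy).
  by rewrite -(fK x) -(fK y) -(fK z); apply: (colP gA); exists j.
by apply: (collinear_same nfxy fxy); apply: (colP fA); exists i.
Qed.

(** Along a line of direction [i] itself, [S x i] cannot change. If it does not change along the
    other lines either, connectedness makes [S] independent of the vertex. *)
Lemma directions_diagonal :
  (forall S : Omega T m -> 'I_m.+1 -> 'I_m.+1,
    (forall x i y, same_part (S x i) (f x) (f y) <-> same_part i x y) ->
    forall i j x y, i != j -> x <> y -> same_part j x y -> S x i = S y i) ->
  diagonal_group T m f.
Proof.
have [S SP] := local_directions => /(_ _ SP) parS.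
have stepS i j x y : same_part j x y -> S x i = S y i.
  move=> jxy; have [-> //|/eqP xy] := eqVneq x y.
  have [ij|ij] := eqVneq i j; last exact: parS jxy.
  rewrite -ij in jxy; apply: (@same_uniq _ _ (f x) (f y)).
  - by move/(graph_aut_inj fA).
  - exact/SP.
  - by apply/same_sym/SP/same_sym.
pose e := cst n (1 : T).
have SE i x : S x i = S e i.
  apply: (@same_ind _ _ (fun z => S z i = S e i) e x) => // p z w _ zw <-.
  exact/esym/stepS/zw.
have S_inj : injective (S e).
  move=> i j ij; apply: (@same_index _ _ Tnt _ _ e) => y.
  by move/SP; rewrite ij => /SP.
apply: (@diagonal_group_of_directions _ _ (perm S_inj)); first exact: fA.1.
by move=> i x y; rewrite permE -(SE i x) => /SP.
Qed.

End DirectionMap.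

(** Relative to [x], the fourth corner takes factor [j] from [y] and factor [i] from [w], rescaled
    by [a^-1] and [b^-1]. *)
Lemma complete_square i j x y w : i != j -> same_part j x y -> same_part i x w ->
  exists z, same_part i y z /\ same_part j w z.
Proof.
move=> ij [a xy] [b xw].
pose u k := if k == j then a^-1 * hc y j else b^-1 * hc w k.
exists (vertex u); split.
  apply: (@same_vertex _ _ _ _ _ a^-1) => k ki; rewrite /u.
  have [->//|kj] := eqVneq k j.
  by rewrite xw // xy // !mulKg.
by apply: (@same_vertex _ _ _ _ _ b^-1) => k kj; rewrite /u (negPf kj).
Qed.

(** * The graph for [m >= 3] *)

Section HighDimension.
Hypothesis n_gt0 : (0 < n)%N.

(** Since [m + 1 >= 4], some factor lies outside [i, j, k]; comparing it gives [c * a = b]. Then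
    factor [i] shows [x = y] if [k != i], and factor [j] shows [x = z] otherwise. *)
Lemma no_triangle i j k x y z : i != j -> x <> y -> x <> z ->
  same_part i x y -> same_part j x z -> ~ same_part k y z.
Proof.
move=> ij xy xz ixy jxz kyz; have [a xyE] := ixy; have [b xzE] := jxz.
have [c yzE] := kyz.
have [|l] := @ex_notin _ [:: i; j; k]; first by rewrite card_ord.
rewrite !inE !negb_or => /and3P[li lj lk].
have cab : c * a = b.
  by apply: (@mulIg _ (hc x l)); rewrite -xzE // yzE // xyE // mulgA.
have [ki|ki] := eqVneq k i; last first.
  apply: xy; apply: (@hc_inj _ _ a) => p; have [->|/xyE//] := eqVneq p i.
  by apply: (@mulgI _ c); rewrite -yzE 1?eq_sym // xzE // mulgA cab.
apply: xz; apply: (@hc_inj _ _ b) => p; have [->|/xzE//] := eqVneq p j.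
by rewrite yzE ?ki 1?eq_sym // xyE 1?eq_sym // mulgA cab.
Qed.

Lemma preserves_collinearity_high f :
  graph_aut adj f -> preserves_collinearity f.
Proof.
move=> fA; apply: (preserves_collinearity_distinct fA) => i x y z xy xz nxy nxz nyz.
have [j fxy] := graph_aut_same fA xy.
have [k fxz] := graph_aut_same fA xz.
have [l fyz] := graph_aut_same fA (same_trans (same_sym xy) xz).
have [jk|jk] := eqVneq j k; first by exists j; split=> //; rewrite jk.
by case: (no_triangle jk _ _ fxy fxz fyz) => /(graph_aut_inj fA).
Qed.

(* For m = 3, the vertices obtained from (1, 1, 1, 1) by putting s in one place
   or t in another have two further common neighbours when s t = 1. *)
Lemma common_neighbour_direction i j k l x v s t :
  i != j -> k != l -> s != 1 -> t != 1 ->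
  (1 < n)%N \/ (hc x i * t) * (hc x i)^-1 * (hc x j * s * (hc x j)^-1) != 1 ->
  same_part k (shift j s x) v -> same_part l (shift i t x) v -> (k == i) || (k == j).
Proof.
move=> ij kl s1 t1 nst [c yv] [d wv].
have [a ya yj] := hc_shift j s x; have [b wb wi] := hc_shift i t x.
apply: contraT; rewrite negb_or => /andP[ki kj].
have vj : hc v j = c * a * hc x j * s by rewrite yv 1?eq_sym // yj !mulgA.
have vy p : p != j -> p != k -> hc v p = c * a * hc x p.
  by move=> pj pk; rewrite yv // ya // mulgA.
have vw p : p != i -> p != l -> hc v p = d * b * hc x p.
  by move=> pj pk; rewrite wv // wb // mulgA.
have cadb p : p \notin [:: i; j; k; l] -> c * a = d * b.
  rewrite !inE !negb_or => /and4P[pi pj pk pl].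
  by apply: (@mulIg _ (hc x p)); rewrite -vy // vw.
have [li|li] := eqVneq l i.
  have [|p pn] := @ex_notin _ [:: i; j; k]; first by rewrite card_ord.
  have pijkl : p \notin [:: i; j; k; l].
    by move: pn; rewrite li !inE !negb_or => /and3P[-> -> ->].
  case/eqP: s1; apply: (@mulgI _ (c * a * hc x j)).
  by rewrite -vj (cadb p) // mulg1 vw // ?li // eq_sym.
have vi : hc v i = d * b * hc x i * t by rewrite wv 1?eq_sym // wi !mulgA.
have cat : c * a = d * b * hc x i * t * (hc x i)^-1.
  by rewrite -vi vy ?mulgK // eq_sym.
suff [p /cadb cadb'] : exists p, p \notin [:: i; j; k; l].
  case/eqP: t1; apply: (@mulgI _ (d * b * hc x i)).
  by rewrite -vi mulg1 -cadb' vy // eq_sym.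
have [lj|lj] := eqVneq l j.
  have [|p] := @ex_notin _ [:: i; j; k]; first by rewrite card_ord.
  by rewrite lj !inE !negb_or => /and3P[pi pj pk]; exists p; rewrite !inE !negb_or pi pj pk.
(* Now [i, j, k, l] are distinct. Either a fifth factor exists, or eliminating [v] yields the
   relation that [nst] excludes. *)
case: nst => [n_gt1|/eqP[]]; first by apply: ex_notin; rewrite card_ord.
apply: (@mulgI _ (d * b)); rewrite mulg1 !mulgA -cat.
by rewrite -vj vw ?mulgK // eq_sym.
Qed.

(** By [no_triangle] the lines from [v] to the two shifted vertices have distinct directions, both
    in [{i, j}]. One assignment forces [v = z], the other [v = x]. *)
Lemma square_common_neighbours i j x z v s t :
  i != j -> s != 1 -> t != 1 ->
  (1 < n)%N \/ (hc x i * t) * (hc x i)^-1 * (hc x j * s * (hc x j)^-1) != 1 ->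
  same_part i (shift j s x) z -> same_part j (shift i t x) z ->
  (exists k, same_part k (shift j s x) v) -> (exists l, same_part l (shift i t x) v) ->
  v = x \/ v = z.
Proof.
move=> ij s1 t1 nst yz wz [k yv] [l wv].
have xy := same_shift j s x; have xw := same_shift i t x.
have [kl|kl] := eqVneq k l.
  have ji : j != i by rewrite eq_sym.
  rewrite kl in yv; have yw := same_trans yv (same_sym wv).
  by case: (no_triangle ji (@shift_neq _ _ _ _ _ s1) (@shift_neq _ _ _ _ _ t1) xy xw yw).
have kij := common_neighbour_direction ij kl s1 t1 nst yv wv.
have lij : (l == j) || (l == i).
  apply: (common_neighbour_direction _ _ t1 s1 _ wv yv); rewrite 1?eq_sym //.
  (* Exchanging [i] and [j] reverses the product, and [A * B = 1] if and only if [B * A = 1]. *)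
  case: nst => [->|nst]; [by left | right; apply: contra_neq nst => nst].
  by rewrite -(mulg1_eq (esym nst)) mulVg.
case/orP: kij => /eqP kE; case/orP: lij => /eqP lE; subst k l.
- by right; apply: (same_eq ij (same_trans (same_sym yv) yz) (same_trans (same_sym wv) wz)).
- by rewrite eqxx in kl.
- by rewrite eqxx in kl.
- left; apply/esym/(same_eq ij); first exact: same_trans xw wv.
  exact: same_trans xy yv.
Qed.

Lemma graph_aut_high f : (1 < n)%N \/ card_ge T 3 ->
  graph_aut adj f -> diagonal_group T m f.
Proof.
move=> nT fA; apply: (directions_diagonal preserves_collinearity_high fA).
move=> S SP i j x y ij xy jxy; have [s ys] := same_shiftP jxy.
have s1 : s != 1 by apply/eqP => s1; apply: xy; rewrite ys s1 shift1.
have [t [t1 nst]] : exists t, t != 1 /\ ((1 < n)%N \/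
    (hc x i * t) * (hc x i)^-1 * (hc x j * s * (hc x j)^-1) != 1).
  case: nT => [n_gt1|T3].
    by have [t /eqP t1] := Tnt; exists t; split=> //; left.
  (* Besides 1, [t] has to avoid the single value that makes the product 1. *)
  have [//|t] := T3 [:: 1; (hc x i)^-1 * (hc x j * s * (hc x j)^-1)^-1 * hc x i].
  rewrite !inE negb_or => /andP[t1 ts]; exists t; split=> //; right.
  apply: contra_neq ts => /(canRL (mulgK _)); rewrite mul1g => <-.
  by rewrite !mulgA mulVg mul1g mulgVK.
have ixw := same_shift i t x.
have [z [yz wz]] := complete_square ij jxy ixw.
have [g [gA fK gK]] := graph_aut_inv fA.
have Sij : S x i != S x j.
  apply: contra_neq ij => Sij; apply: (@same_index _ _ Tnt _ _ x) => v.
  by move/SP; rewrite Sij => /SP.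
(* [u] completes the image square, so [g u] is a common neighbour of [y] and [w]. It is not [x],
   hence [u = f z], and the line through [f y] and [f z] has direction both [S x i] and [S y i]. *)
have [u [yu wu]] := complete_square Sij ((SP x j y).2 jxy) ((SP x i _).2 ixw).
have nfxy : f x <> f y by move/(graph_aut_inj fA).
have nyz : y <> z.
  move=> yzE; have /eqP[] := ij; apply: (same_uniq (shift_neq t1) ixw).
  by apply: same_trans jxy _; rewrite yzE; apply: same_sym.
have nfyz : f y <> f z by move/(graph_aut_inj fA).
have [] := @square_common_neighbours i j x z (g u) s t ij s1 t1 nst; rewrite -?ys //.
- by have := graph_aut_same gA yu; rewrite fK.
- by have := graph_aut_same gA wu; rewrite fK.
- move=> guE; case: nfxy; apply: (same_eq Sij); last exact/SP.
  by have uE : u = f x by [rewrite -guE gK]; rewrite uE in yu; apply: same_sym.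
by move=> guE; apply: (same_uniq nfyz); [rewrite -guE gK | exact/SP].
Qed.

End HighDimension.

End Graph.

(** * The graph for [m = 2] *)

Section Plane.
Variable T : groupType.
Implicit Types (x y z w v p q r : Omega T 2) (i j k l : 'I_3) (f g h : Omega T 2 -> Omega T 2).
Hypothesis Tnt : exists t : T, t <> 1.

Local Notation adj := (diagonal_graph T 2).

Lemma third_index i j k l : i != j -> k != i -> k != j -> l != i -> l != j -> l = k.
Proof.
move=> ij ki kj li lj; apply/eqP; apply: contraT => lk.
have u : uniq [:: i; j; k; l].
  by rewrite /= !inE !negb_or ij ![i == _]eq_sym ki li ![j == _]eq_sym kj lj eq_sym lk.
by have := max_card (mem [:: i; j; k; l]); rewrite (card_uniqP u) card_ord.
Qed.

Lemma lines_meet i j x y : i != j -> exists z, same_part i x z /\ same_part j y z.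
Proof.
move=> ij; have [k /andP[ki kj]] := ex_other i j.
(* Scaling [y] by [c] makes it agree with [x] in the third factor. *)
pose c := hc x k * (hc y k)^-1.
exists (vertex (fun l => if l == i then c * hc y i else hc x l)); split.
  by apply: (@same_vertex _ _ _ _ _ 1) => l /negPf->; rewrite mul1g.
apply: (@same_vertex _ _ _ _ _ c) => l lj; have [->//|li] := eqVneq l i.
by rewrite (third_index ij ki kj li lj) mulgVK.
Qed.

Lemma triangle_directions i j k x y z : i != j -> x <> y -> x <> z ->
  same_part i x y -> same_part j x z -> same_part k y z -> k != i /\ k != j.
Proof.
move=> ij xy xz ixy jxz kyz; split; apply/eqP => kE; rewrite kE in kyz.
  by apply/xz/(same_eq ij) => //; apply: same_trans kyz.
by apply/xy/(same_eq ij) => //; apply: same_trans jxz (same_sym kyz).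
Qed.

(** If [x w] had direction [i], the triangle [x, z, w] would give [z w] direction [k], and [y w]
    would have both directions [i] and [k]; similarly for [j]. So opposite edges are parallel. *)
Lemma quadrangle_directions i j k x y z w : i != j ->
  adj x y -> adj x z -> adj x w -> adj y w -> adj z w ->
  same_part i x y -> same_part j x z -> same_part k y z ->
  [/\ same_part k x w, same_part j y w & same_part i z w].
Proof.
move=> ij xy xz xw yw zw ixy jxz kyz.
have nxy := xy.1; have nxz := xz.1; have nxw := xw.1.
have [ki kj] := triangle_directions ij nxy nxz ixy jxz kyz.
have [a axw] := adj_near xw; have [b byw] := adj_near yw; have [c czw] := adj_near zw.
have ai : a != i.
  apply/eqP => ai; rewrite ai in axw; have ji : j != i by rewrite eq_sym.
  have [cj ci] := triangle_directions ji nxz nxw jxz axw czw.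
  have ck := third_index ij ki kj ci cj; rewrite ck in czw.
  have iyw := same_trans (same_sym ixy) axw.
  have kyw := same_trans kyz czw.
  by move: ki; rewrite (same_uniq yw.1 kyw iyw) eqxx.
have aj : a != j.
  apply/eqP => aj; rewrite aj in axw.
  have [bi bj] := triangle_directions ij nxy nxw ixy axw byw.
  have bk := third_index ij ki kj bi bj; rewrite bk in byw.
  have jzw := same_trans (same_sym jxz) axw.
  have kzw := same_trans (same_sym kyz) byw.
  by move: kj; rewrite (same_uniq zw.1 kzw jzw) eqxx.
have ak := third_index ij ki kj ai aj; rewrite ak in axw.
have ik : i != k by rewrite eq_sym.
have jk : j != k by rewrite eq_sym.
have [bi bk] := triangle_directions ik nxy nxw ixy axw byw.
have [cj ck] := triangle_directions jk nxz nxw jxz axw czw.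
have ji : j != i by rewrite eq_sym.
split=> //; first by rewrite -(third_index ik ji jk bi bk).
by rewrite -(third_index jk ij ik cj ck).
Qed.

(** Otherwise [w] and [v] would both be the intersection of the line of direction [k] through [x]
    and that of direction [j] through [y]. *)
Lemma clique5_collinear x y z w v :
  adj x y -> adj x z -> adj y z -> adj x w -> adj y w -> adj z w ->
  adj x v -> adj y v -> adj z v -> w <> v -> collinear x y z.
Proof.
move=> xy xz yz xw yw zw xv yv zv wv.
have [i ixy] := adj_near xy; have [j jxz] := adj_near xz; have [k kyz] := adj_near yz.
have [ij|ij] := eqVneq i j; first by exists i; split=> //; rewrite ij.
have [kxw jyw _] := quadrangle_directions ij xy xz xw yw zw ixy jxz kyz.
have [kxv jyv _] := quadrangle_directions ij xy xz xv yv zv ixy jxz kyz.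
have [_ kj] := triangle_directions ij xy.1 xz.1 ixy jxz kyz.
case: wv; apply: (same_eq kj).
  exact: same_trans (same_sym kxw) kxv.
exact: same_trans (same_sym jyw) jyv.
Qed.

(** Eliminating the multipliers by comparing factors turns factor [i] of [w] into
    [c * hc x i = c * hc x i * t * t]. *)
Lemma quadrangle_involution i j k x y z w t : i != j -> k != i -> k != j ->
  y = shift i t x -> same_part j x z -> same_part k x w -> same_part k y z -> same_part j y w ->
  same_part i z w -> t * t = 1.
Proof.
move=> ij ki kj -> [b xz] [c xw] [d yz] [d' yw] [e zw].
have [a ya yi] := hc_shift i t x.
have zi : b * hc x i = d * a * hc x i * t.
  by rewrite -xz // yz 1?eq_sym // yi !mulgA.
have wi : c * hc x i = d' * a * hc x i * t.
  by rewrite -xw 1?eq_sym // yw // yi !mulgA.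
have cE : c = e * d * a.
  apply: (@mulIg _ (hc x j)); rewrite -xw 1?eq_sym // zw 1?eq_sym //.
  by rewrite yz 1?eq_sym // ya 1?eq_sym // !mulgA.
have dE : d' * a = e * b.
  apply: (@mulIg _ (hc x k)); rewrite -mulgA -ya // -yw // zw // xz //.
  by rewrite mulgA.
apply: (@mulgI _ (c * hc x i)); rewrite mulg1 [RHS]wi dE -(mulgA e) zi cE.
by rewrite !mulgA.
Qed.

Lemma quadrangle_collinear i x t z w : t * t <> 1 ->
  adj x (shift i t x) -> adj x z -> adj x w ->
  adj (shift i t x) z -> adj (shift i t x) w -> adj z w -> same_part i x z.
Proof.
move=> tt xy xz xw yz yw zw; have ixy := same_shift i t x.
have [j jxz] := adj_near xz; have [k kyz] := adj_near yz.
have [->//|ij] := eqVneq i j.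
have [ki kj] := triangle_directions ij xy.1 xz.1 ixy jxz kyz.
have [kxw jyw izw] := quadrangle_directions ij xy xz xw yw zw ixy jxz kyz.
by case: tt; apply: (quadrangle_involution ij ki kj erefl jxz kxw kyz jyw izw).
Qed.

Lemma line_extend c i x (s : seq (Omega T 2)) : card_ge T c ->
  (size s < c)%N -> exists y, same_part i x y /\ y \notin s.
Proof.
move=> Tc sc.
(* Points of the list off the line get the dummy value 1. *)
have /choice[t tP] (y : Omega T 2) : exists t, same_part i x y -> y = shift i t x.
  by have [/same_shiftP[t ->]|nxy] := pselect (same_part i x y); [exists t | exists 1].
have [|r rs] := Tc (map t s); first by rewrite size_map.
exists (shift i r x); split; first exact: same_shift.
apply: contra rs => rs; apply/mapP; exists (shift i r x) => //.
by apply: (@shift_inj _ _ i x) => /=; rewrite -tP //; apply: same_shift.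
Qed.

Lemma preserves_collinearity_ge5 f : card_ge T 5 ->
  graph_aut adj f -> preserves_collinearity f.
Proof.
move=> T5 fA; apply: (preserves_collinearity_distinct fA) => i x y z xy xz nxy nxz nyz.
have [|w [xw]] := @line_extend 5 i x [:: x; y; z] T5; first by [].
rewrite !inE !negb_or => /and3P[/eqP wx /eqP wy /eqP wz].
have [|v [xv]] := @line_extend 5 i x [:: x; y; z; w] T5; first by [].
rewrite !inE !negb_or => /and4P[/eqP vx /eqP vy /eqP vz /eqP vw].
have fadj p q : same_part i x p -> same_part i x q -> p <> q -> adj (f p) (f q).
  by move=> xp xq pq; apply/(fA.2)/(adj_same pq xp xq).
have xx := same_refl i x.
apply: (@clique5_collinear _ _ _ (f w) (f v)); try (apply: fadj => //; exact: nesym).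
by move/(graph_aut_inj fA)/esym.
Qed.

(** The line through [f x] and [f q] has two further points [u] and [v]. As [t * t <> 1], the
    4-clique [x, q, g u, g v] lies on the line of direction [i]. If [f r] were off the image line,
    it would form a 5-clique with [f x, f q, u, v], which forces it back onto that line. *)
Lemma preserves_collinearity_ge4 f :
  card_ge T 4 -> (exists t : T, t * t <> 1) ->
  graph_aut adj f -> preserves_collinearity f.
Proof.
move=> T4 [t tt] fA; have [g [gA fK gK]] := graph_aut_inv fA.
move=> x y z [i [xy xz]].
have t1 : t != 1 by apply/eqP => t1; apply: tt; rewrite t1 mulg1.
pose q := shift i t x; have xq : same_part i x q := same_shift i t x.
have nxq : x <> q := shift_neq t1.
have [k fxq] := graph_aut_same fA xq.
have nfxq : f x <> f q by move/(graph_aut_inj fA).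
suff line r : same_part i x r -> same_part k (f x) (f r) by exists k; split; apply: line.
move=> xr; have [<-|/eqP nxr] := eqVneq x r; first exact: same_refl.
have [<-//|/eqP nqr] := eqVneq q r.
have [//|nline] := pselect (same_part k (f x) (f r)).
have [|u [xu]] := @line_extend 4 k (f x) [:: f x; f q] T4; first by [].
rewrite !inE !negb_or => /andP[/eqP ux /eqP uq].
have [|v [xv]] := @line_extend 4 k (f x) [:: f x; f q; u] T4; first by [].
rewrite !inE !negb_or => /and3P[/eqP vx /eqP vq /eqP vu].
have xx := same_refl k (f x).
have gadj a b : same_part k (f x) a -> same_part k (f x) b -> a <> b -> adj (g a) (g b).
  by move=> xa xb ab; apply/(gA.2)/(adj_same ab xa xb).
have gxu := gadj _ _ xx xu (nesym ux); have gxv := gadj _ _ xx xv (nesym vx).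
have gqu := gadj _ _ fxq xu (nesym uq); have gqv := gadj _ _ fxq xv (nesym vq).
have guv := gadj _ _ xu xv (nesym vu).
have gvu := gadj _ _ xv xu vu.
have axq := same_adj nxq xq; rewrite !fK in gxu gxv gqu gqv.
have igu := quadrangle_collinear tt axq gxu gxv gqu gqv guv.
have igv := quadrangle_collinear tt axq gxv gxu gqv gqu gvu.
have fadj a b : same_part i x a -> same_part i x b -> a <> b -> adj (f a) (f b).
  by move=> xa xb ab; apply/(fA.2)/(adj_same ab xa xb).
have ru : r <> g u by move=> ru; apply: nline; rewrite ru gK.
have rv : r <> g v by move=> rv; apply: nline; rewrite rv gK.
have fru := fadj _ _ xr igu ru; have frv := fadj _ _ xr igv rv.
have fxr := fadj _ _ (same_refl i x) xr nxr; have fqr := fadj _ _ xq xr nqr.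
rewrite !gK in fru frv.
apply: (collinear_same nfxq fxq).
apply: (clique5_collinear _ fxr fqr _ _ fru _ _ frv (nesym vu)).
- exact: same_adj fxq.
- exact: same_adj (nesym ux) xu.
- exact: adj_same (nesym uq) fxq xu.
- exact: same_adj (nesym vx) xv.
- exact: adj_same (nesym vq) fxq xv.
Qed.

Lemma graph_aut_plane f :
  card_ge T 5 \/ card_ge T 4 /\ (exists t : T, t * t <> 1) ->
  graph_aut adj f -> diagonal_group T 2 f.
Proof.
move=> Tcases fA.
have colP h : graph_aut adj h -> preserves_collinearity h.
  case: Tcases => [T5|[T4 Tt]]; first exact: preserves_collinearity_ge5.
  exact: preserves_collinearity_ge4.
apply: (directions_diagonal Tnt colP fA) => S SP i j x y ij xy jxy.
have [//|Sxy] := eqVneq (S x i) (S y i).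
have [g [gA fK gK]] := graph_aut_inv fA.
(* If the directions differed, the preimage of the meeting point would lie on the lines of direction
   [i] through [x] and through [y]. *)
have [z [xz yz]] := lines_meet (f x) (f y) Sxy.
rewrite -(gK z) in xz yz; move/SP in xz; move/SP in yz.
by case: xy; apply: (same_eq ij) => //; apply: same_trans xz (same_sym yz).
Qed.

End Plane.

(** * Groups of order at most 4 *)

Section SmallGroups.
Variable T : groupType.

(** [f] maps onto [T], which has [#|G|] elements, so it is injective and its inverse is the
    isomorphism. *)
Lemma isomorphic_of_morph (G : finGroupType) (f : G -> T) (s : seq T) :
  {morph f : x y / x * y} -> uniq s -> size s = #|G| ->
  (forall b, b \in s) -> (forall b, b \in s -> exists a, f a = b) ->
  isomorphic T G.
Proof.
move=> fM us sG sT fs.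
have f_inj : injective f.
  apply/injectiveP/(leq_size_uniq us); last by rewrite size_codom sG.
  by move=> b /fs[a <-]; apply: codom_f.
have /choice[g gP] b : exists a, f a = b by apply: fs.
exists g; split; first by exists f => // a; apply: f_inj; rewrite gP.
by move=> x y; apply: f_inj; rewrite fM !gP.
Qed.

Lemma isomorphic_cyclic (n : nat) (t : T) (s : seq T) : t ^+ n.+2 = 1 ->
  uniq s -> size s = n.+2 -> (forall b, b \in s) ->
  (forall b, b \in s -> exists2 i, (i < n.+2)%N & t ^+ i = b) ->
  isomorphic T 'Z_n.+2.
Proof.
move=> tn us sn sT st.
apply: (@isomorphic_of_morph _ (fun i : 'Z_n.+2 => t ^+ i) s) => //.
- move=> i j /=; rewrite -expgnDr [in RHS](divn_eq (i + j) n.+2).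
  by rewrite expgnDr mulnC expgnA tn expg1n mul1g.
- by rewrite card_ord.
- by move=> b /st[i ni <-]; exists (Ordinal ni).
Qed.

Lemma isomorphic_Z2 (t : T) :
  t != 1 -> (forall x, x \in [:: 1; t]) -> isomorphic T 'Z_2.
Proof.
move=> t1 T2; apply: (@isomorphic_cyclic 0 t [:: 1; t]) => //.
- have := T2 (t * t); rewrite !inE expgS expg1 => /orP[/eqP//|/eqP tt].
  by case/eqP: t1; apply: (@mulgI _ t); rewrite tt mulg1.
- by rewrite /= inE eq_sym t1.
- by move=> b; rewrite !inE => /orP[]/eqP->; [exists 0%N | exists 1%N].
Qed.

Lemma isomorphic_Z3 (t s : T) : uniq [:: 1; t; s] ->
  (forall x, x \in [:: 1; t; s]) -> isomorphic T 'Z_3.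
Proof.
move=> u3 T3; have := u3; rewrite /= !inE negb_or !andbT => /andP[/andP[t1 s1] ts].
have ts1 : t * s = 1.
  have := T3 (t * s); rewrite !inE => /or3P[]/eqP // E.
    by case/eqP: s1; apply: (@mulgI _ t); rewrite E mulg1.
  by case/eqP: t1; apply: (@mulIg _ s); rewrite E mul1g.
have tts : t * t = s.
  have := T3 (t * t); rewrite !inE => /or3P[]/eqP // E.
    by case/eqP: ts; apply: (@mulgI _ t); rewrite E.
  by case/eqP: t1; apply: (@mulgI _ t); rewrite E mulg1.
apply: (@isomorphic_cyclic 1 t [:: 1; t; s]) => //.
  by rewrite !expgS expg0 mulg1 tts.
move=> b; rewrite !inE => /or3P[]/eqP->; [exists 0%N|exists 1%N|exists 2] => //.
Qed.

Lemma isomorphic_Z2xZ2 (t s r : T) : uniq [:: 1; t; s; r] ->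
  (forall x, x \in [:: 1; t; s; r]) -> (forall x : T, x * x = 1) ->
  isomorphic T ('Z_2 * 'Z_2)%type.
Proof.
move=> u4 T4 Tinv; have := u4; rewrite /= !inE !negb_or !andbT.
case/and3P=> /and3P[t1 s1 _] /andP[ts _] _.
have tsr : t * s = r.
  have := T4 (t * s); rewrite !inE => /or4P[]/eqP // E.
  - by case/eqP: ts; apply: (@mulgI _ t); rewrite E Tinv.
  - by case/eqP: s1; apply: (@mulgI _ t); rewrite E mulg1.
  - by case/eqP: t1; apply: (@mulIg _ s); rewrite E mul1g.
have invE (x : T) : x^-1 = x by apply: mulg1_eq.
(* Exponent two makes the group abelian. *)
have comm (x y : T) : x * y = y * x by rewrite -[LHS]invE invMg !invE.
have expM (x : T) (i j : 'Z_2) : x ^+ (i * j)%g = x ^+ i * x ^+ j.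
  rewrite -expgnDr [in RHS](divn_eq (i + j) 2).
  by rewrite expgnDr mulnC expgnA expgS expg1 Tinv expg1n mul1g.
apply: (@isomorphic_of_morph _ (fun a : 'Z_2 * 'Z_2 => t ^+ a.1 * s ^+ a.2)
          [:: 1; t; s; r]) => //.
- move=> [a b] [c d] /=; rewrite !expM !mulgA; congr (_ * _).
  by rewrite -!mulgA (comm (t ^+ c)).
- by rewrite card_prod !card_ord.
- pose z : 'Z_2 := Ordinal (isT : (0 < 2)%N); pose o : 'Z_2 := Ordinal (isT : (1 < 2)%N).
  move=> b; rewrite !inE => /or4P[]/eqP->;
    [exists (z, z) | exists (o, z) | exists (z, o) | exists (o, o)] => //=;
    by rewrite ?expg0 ?expg1 ?mul1g ?mulg1.
Qed.

End SmallGroups.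

(** A list of distinct elements is extended one at a time. If it is complete at length 2 or 3, [T]
    is cyclic; at length 4, either [T] has exponent two or some square is not 1. *)
Lemma card_or_isomorphic (T : groupType) : (exists t : T, t <> 1) ->
  [\/ isomorphic T 'Z_2, isomorphic T 'Z_3, isomorphic T ('Z_2 * 'Z_2)%type
    | card_ge T 5 \/ card_ge T 4 /\ exists t : T, t * t <> 1].
Proof.
have ext (s : seq T) : uniq s -> (forall x, x \in s) \/ exists x, uniq (rcons s x).
  move=> us; have [|/existsNP[x /negP xs]] := pselect (forall x, x \in s); first by left.
  by right; exists x; rewrite rcons_uniq xs.
move=> [t /eqP t1]; have u2 : uniq [:: 1; t] by rewrite /= inE eq_sym t1.
have [T2|[s u3]] := ext _ u2; first by constructor 1; apply: isomorphic_Z2 T2.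
have [T3|[r u4]] := ext _ u3; first by constructor 2; apply: isomorphic_Z3 T3.
have [T4|[q u5]] := ext _ u4; last first.
  by constructor 4; left; apply: uniq_card_ge u5.
have [Tinv|/existsNP[x xx]] := pselect (forall x : T, x * x = 1).
  by constructor 3; apply: isomorphic_Z2xZ2 T4 _.
by constructor 4; right; split; [apply: uniq_card_ge u4 | exists x].
Qed.

(* As a groupType, 'Z_n is the additive group of integers modulo n. *)
Theorem corollary7p2 (T : groupType) (m : nat)
    (T_nontrivial : exists t : T, t <> 1%g)
    (m_ge2 : (2 <= m)%N)
    (not_exceptional :
       ~ [\/ isomorphic T 'Z_2 /\ m = 2,
             isomorphic T 'Z_3 /\ m = 2,
             isomorphic T ('Z_2 * 'Z_2)%type /\ m = 2
           | isomorphic T 'Z_2 /\ m = 3]) :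
  partitions_aut (diagonal_semilattice T m) = diagonal_group T m /\
  graph_aut (diagonal_graph T m) = diagonal_group T m.
Proof.
case: m m_ge2 not_exceptional => [|[|n]] // _ exc.
split; first exact: semilattice_autE.
apply/seteqP; split=> f; last exact: diagonal_group_graph.
case: n exc f => [|n] exc f.
  apply: graph_aut_plane => //.
  have [T2|T3|T4|//] := card_or_isomorphic T_nontrivial; case: exc.
  - by constructor 1.
  - by constructor 2.
  - by constructor 3.
(* For [m >= 4] the first alternative holds; for [m = 3], a third element exists because [T] is not
   of order 2. *)
apply: graph_aut_high => //; case: n {f} exc => [|n] exc; last by left.
right; have [t /eqP t1] := T_nontrivial.
have [T2|/existsNP[s /negP sT]] := pselect (forall x, x \in [:: 1; t]).
  by case: exc; constructor 4; split=> //; apply: isomorphic_Z2 T2.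
apply: (@uniq_card_ge _ [:: s; 1; t]).
by rewrite cons_uniq sT /= inE eq_sym t1.
Qed.
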